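(* Let $A$ be a semiring. (1) The collection of all ideals and the collection of all proper ideals of $A$ are spectral spaces with the hull-kernel topology. (2) The collection $\mathrm{Spec}\,A$ of all prime ideals of $A$ is a spectral space with the hull-kernel topology. (3) The collection of all $k$-ideals of $A$ is a spectral space with the hull-kernel topology. (4) The collection of all prime $k$-ideals of $A$ is a spectral space with the hull-kernel topology.
   Context: A semiring is a nonempty set $A$ with operations $+,\cdot$ such that $(A,+)$ and $(A,\cdot)$ are commutative monoids (with identities $0$ and $1$), $(a+b)c=ac+bc$ and $0\cdot a=0$. An ideal of $A$ is an additive submonoid $I$ with $AI\subseteq I$; it is proper if $I\ne A$; a prime ideal is a proper ideal $\mathfrak p$ such that $ab\in\mathfrak p$ implies $a\in\mathfrak p$ or $b\in\mathfrak p$. A $k$-ideal is an ideal $I$ such that $x\in I$ and $x+y\in I$ imply $y\in I$. For $k$-ideals $I,J$, the product $IJ$ is the smallest $k$-ideal containing $\{xy\mid x\in I,y\in J\}$. A prime $k$-ideal is a proper $k$-ideal $\mathfrak p$ such that for all $k$-ideals $I,J$, $IJ\subseteq\mathfrak p$ implies $I\subseteq\mathfrak p$ or $J\subseteq\mathfrak p$. The hull-kernel topology on $2^A$ has as open sub-basis the sets $D(F)=\{I\in 2^A\mid F\not\subseteq I\}$ with $F\subseteq A$ finite; each collection above carries the induced subspace topology. A spectral space is a quasi-compact $T_0$ topological space in which finite intersections of quasi-compact open subsets are quasi-compact open, the quasi-compact open subsets form a basis, and every nonempty irreducible closed subset has a unique generic point. *)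

(* Defs.v *)
From HB Require Import structures.
From mathcomp Require Import all_boot all_order all_algebra.
From mathcomp Require Import all_classical.
From mathcomp Require Import topology.
Set Implicit Arguments.
Unset Strict Implicit.
Unset Printing Implicit Defensive.
Import GRing.Theory.
Local Open Scope classical_set_scope.
Local Open Scope ring_scope.

(* The library's [compact] does not include any separation axiom. *)
Definition qc_open (X : topologicalType) : set (set X) :=
  [set U | open U /\ compact U].

Definition irreducible (X : topologicalType) (Z : set X) : Prop :=
  Z !=set0 /\
  forall C D : set X, closed C -> closed D -> Z `<=` C `|` D ->
    Z `<=` C \/ Z `<=` D.

Record spectral_space (X : topologicalType) : Prop := SpectralSpace {
  spectral_compact : compact [set: X];
  spectral_T0 : kolmogorov_space X;
  spectral_bigcap : forall F : set (set X), finite_set F ->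
    F `<=` @qc_open X -> qc_open (\bigcap_(U in F) U);
  spectral_basis : basis (@qc_open X);
  spectral_sober : forall Z : set X, closed Z -> irreducible Z ->
    exists! x : X, closure [set x] = Z }.

(* An alias of [set A], so that the hull-kernel topology does not interfere
   with any other topology on the function type [A -> Prop]. *)
Definition hull_kernel (A : Type) : Type := set A.

Definition hull_kernel_D (A : Type) (F : set A) : set (hull_kernel A) :=
  [set I : set A | ~ (F `<=` I)].

HB.instance Definition _ (A : Type) := Pointed.copy (hull_kernel A) (set A).
HB.instance Definition _ (A : Type) :=
  isSubBaseTopological.Build (hull_kernel A)
    (@finite_set A) (@hull_kernel_D A).

(* Sets of type [set (hull_kernel A)] coerce to subtypes ([set_type]), which
   carry the induced topology (subtype_topology.v). [comPzSemiRingType] is a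
   commutative semiring in which [0 = 1] is allowed. *)

Section Ideals.
Variable A : comPzSemiRingType.
Implicit Types I J P : set A.

Definition is_ideal I : Prop :=
  [/\ I 0, (forall x y, I x -> I y -> I (x + y)) &
      (forall a x, I x -> I (a * x))].

Definition is_proper I : Prop := I <> [set: A].

Definition is_prime_ideal P : Prop :=
  [/\ is_ideal P, is_proper P & forall a b, P (a * b) -> P a \/ P b].

Definition is_k_ideal I : Prop :=
  is_ideal I /\ forall x y, I x -> I (x + y) -> I y.

Definition k_ideal_mul I J : set A :=
  smallest is_k_ideal [set x * y | x in I & y in J].

Definition is_prime_k_ideal P : Prop :=
  [/\ is_k_ideal P, is_proper P &
      forall I J, is_k_ideal I -> is_k_ideal J ->
        k_ideal_mul I J `<=` P -> I `<=` P \/ J `<=` P].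

Lemma is_k_ideal_mul I J : is_k_ideal (k_ideal_mul I J).
Proof.
split; first split.
- by move=> K [[[]]].
- by move=> x y Kx Ky K [kK sK]; case: (kK) => -[_ + _] _; apply;
    [exact: Kx | exact: Ky].
- by move=> a x Kx K [kK sK]; case: (kK) => -[_ _ +] _; apply; exact: Kx.
- by move=> x y Kx Kxy K [kK sK]; case: (kK) => _; apply; [exact: Kx | exact: Kxy].
Qed.

Definition ideals : set (hull_kernel A) := [set I | is_ideal I].
Definition proper_ideals : set (hull_kernel A) :=
  [set I | is_ideal I /\ is_proper I].
Definition Spec : set (hull_kernel A) := [set P | is_prime_ideal P].
Definition k_ideals : set (hull_kernel A) := [set I | is_k_ideal I].
Definition prime_k_ideals : set (hull_kernel A) :=
  [set P | is_prime_k_ideal P].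

End Ideals.

Arguments ideals : clear implicits.
Arguments proper_ideals : clear implicits.
Arguments Spec : clear implicits.
Arguments k_ideals : clear implicits.
Arguments prime_k_ideals : clear implicits.

(* Main.v *)
(** Each of the five collections [X] is closed under ultralimits: for an
    ultrafilter [U] on [X], the set of those [a] that lie in [U]-almost all
    members of [X] again belongs to [X].  This ultralimit is a limit of [U] for
    the hull-kernel topology, and because opens are closed under passing to
    smaller members of [X], the quasi-compact open sets are exactly the opens
    stable under ultralimits, whence finite intersections of them are again
    quasi-compact open.  The
    generic point of an irreducible closed [Z] is the ultralimit of an
    ultrafilter containing all the traces on [Z] of the opens meeting [Z].  For
    [k]-ideals, primality with respect to products of [k]-ideals is equivalent
    to elementwise primality, as one sees on principal [k]-ideals; hence it is
    also preserved by ultralimits. *)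
Require Import Defs.
From mathcomp Require Import all_boot all_order all_algebra.
From mathcomp Require Import all_classical.
From mathcomp Require Import topology.
Set Implicit Arguments.
Unset Strict Implicit.
Unset Printing Implicit Defensive.
Import GRing.Theory.
Local Open Scope classical_set_scope.
Local Open Scope ring_scope.

Lemma open_hull_kernelP (A : Type) (O : set (hull_kernel A)) :
  open O <-> exists2 B : set (set (hull_kernel A)),
    B `<=` finI_from (@finite_set A) (@hull_kernel_D A) &
    \bigcup_(V in B) V = O.
Proof. by []. Qed.

(** * The hull-kernel topology on a collection of subsets *)

Section HullKernel.
Variables (A : Type) (X : set (hull_kernel A)).
Implicit Types (x y : X) (a : A).

Definition elts x : set A := set_val x.

(** The trace on [X] of the subbasic open set of [[set a]]; the trace for a finite [F] is the union
    of these over [a] in [F]. *)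
Definition avoiding a : set X := [set x | ~ elts x a].

Lemma elts_inj x y : elts x = elts y -> x = y.
Proof. exact: val_inj. Qed.

Lemma open_avoiding a : open (avoiding a).
Proof.
exists (@hull_kernel_D A [set a]).
  apply/open_hull_kernelP; exists [set @hull_kernel_D A [set a]].
    by move=> _ ->; apply: finI_from1; exact: finite_set1.
  by rewrite bigcup_set1.
by apply/seteqP; split=> x /=; rewrite /hull_kernel_D /= sub1set inE.
Qed.

(** A subbasic neighbourhood of [x] given by a finite set contains [avoiding a] for some [a] of that
    set outside [x], so singletons suffice to test convergence. *)
Lemma cvg_avoiding (F : set_system X) x : Filter F ->
  (forall a, ~ elts x a -> F (avoiding a)) -> F --> x.
Proof.
move=> FF Fx N; rewrite nbhsE.
move=> -[_ [[O /open_hull_kernelP[B BI <-] <-] [V BV Vx]] sN].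
have [D finD VE] := BI _ BV.
suff : F (set_val @^-1` V) by apply: filterS => y Vy; apply: sN; exists V.
rewrite -{}VE in Vx *; rewrite preimage_bigcap.
apply: filter_bigI => G GD.
have /existsNP[a /not_implyP[Ga xa]] := Vx _ GD.
by apply: filterS (Fx a xa) => y ya /(_ _ Ga).
Qed.

Lemma open_down (O : set X) x y :
  open O -> elts x `<=` elts y -> O y -> O x.
Proof.
move=> oO sxy Oy; have : principal_filter x --> y.
  by apply: cvg_avoiding => a nya; apply/principal_filterP => /sxy.
by move=> /(_ O); move/(_ (open_nbhs_nbhs (conj oO Oy))) => /principal_filterP.
Qed.

Lemma kolmogorov_hull_kernel : kolmogorov_space X.
Proof.
move=> x y xy.
have sep u v a : elts u a -> ~ elts v a ->
    avoiding a \in nbhs v /\ u \in ~` avoiding a.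
  move=> ua va; split; rewrite inE; last by move=> /=; apply.
  by apply: open_nbhs_nbhs; split; first exact: open_avoiding.
have [sxy|/existsNP[a /not_implyP[xa ya]]] :=
  pselect (elts x `<=` elts y); last first.
  by exists (avoiding a); right; exact: sep.
have [syx|/existsNP[a /not_implyP[ya xa]]] :=
  pselect (elts y `<=` elts x); last first.
  by exists (avoiding a); left; exact: sep.
by move/eqP: xy; case; apply: elts_inj; apply/seteqP.
Qed.

Definition ultralimit (U : set_system X) : hull_kernel A :=
  [set a | U [set x | elts x a]].

Lemma ultralimitPn (U : set_system X) a : UltraFilter U ->
  ~ ultralimit U a -> U (avoiding a).
Proof.
by move=> UU La; have [|] := in_ultra_setVsetC [set x | elts x a] UU.
Qed.

Lemma avoiding_ultralimit (U : set_system X) a : UltraFilter U ->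
  U (avoiding a) -> ~ ultralimit U a.
Proof.
move=> UU Ua La.
have /filter_ex[x []] : U (avoiding a `&` [set x | elts x a]); last by [].
exact: filterI.
Qed.

(* Closedness in the constructible (patch) topology, that of [2 ^ A]. *)
Definition ultraclosed (C : set X) :=
  forall (U : set_system X) x, UltraFilter U -> elts x = ultralimit U ->
    U C -> C x.

(** * Spectrality of collections closed under ultralimits *)

Hypothesis X_ultralimit : forall U : set_system X, UltraFilter U ->
  X (ultralimit U).

Definition ultrapoint (U : set_system X) (UU : UltraFilter U) : X :=
  SigSub (mem_set (X_ultralimit UU)).

Lemma cvg_ultrapoint U (UU : UltraFilter U) : U --> ultrapoint UU.
Proof. by apply: cvg_avoiding => a /(ultralimitPn UU). Qed.

Lemma ultraclosed_compact (C : set X) : ultraclosed C -> compact C.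
Proof.
move=> clC; rewrite compact_ultra => U UU UC.
by exists (ultrapoint UU); split; [exact: clC UC|exact: cvg_ultrapoint].
Qed.

Lemma qc_openP (K : set X) : qc_open K <-> open K /\ ultraclosed K.
Proof.
split=> [[oK cK]|[oK clK]]; last by split=> //; exact: ultraclosed_compact.
split=> // U x UU xU UK; move: (cK); rewrite compact_ultra.
move=> /(_ U UU UK)[y [Ky Uy]].
(* The ultralimit [x] is contained in every limit [y] of [U], and [K] passes from [y] down to
   [x]. *)
apply: open_down oK _ Ky; rewrite xU => a La; apply: contrapT => ya.
apply: avoiding_ultralimit La; apply: Uy.
by apply: open_nbhs_nbhs; split; first exact: open_avoiding.
Qed.

Lemma qc_open_avoiding a : qc_open (avoiding a).
Proof.
apply/qc_openP; split=> [|U x UU xU Ua]; first exact: open_avoiding.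
by rewrite /avoiding /= xU; exact: avoiding_ultralimit.
Qed.

Lemma qc_open_bigcap (F : set (set X)) : finite_set F ->
  F `<=` @qc_open X -> qc_open (\bigcap_(V in F) V).
Proof.
move=> /finite_fsetP[D ->] Fqc; apply/qc_openP; split.
  rewrite openE => x Fx; apply: filter_bigI => V DV.
  by apply: open_nbhs_nbhs; split; [have [] := Fqc _ DV|exact: Fx].
move=> U x UU xU UF V DV; have /qc_openP[_ clV] := Fqc _ DV.
by apply: clV xU _; apply: filterS UF => y; exact.
Qed.

Lemma basis_qc_open : basis (@qc_open X).
Proof.
split=> [V []//|x]; apply: cvg_avoiding => [|a xa]; last first.
  by exists (avoiding a) => //; split=> //; exact: qc_open_avoiding.
apply: filter_from_filter.
  (* The whole space is quasi-compact open as an empty intersection. *)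
  exists setT; split=> //; rewrite -(bigcap_set0 (@id (set X))).
  by apply: qc_open_bigcap => //; exact: finite_set0.
move=> V W [qcV Vx] [qcW Wx]; exists (V `&` W) => //; split=> //.
have -> : V `&` W = \bigcap_(O in [set V; W]) O.
  by rewrite bigcap_setU !bigcap_set1.
apply: qc_open_bigcap; first exact: finite_set2.
by move=> O [->|->].
Qed.

Lemma closure_point x : closure [set x] = [set y | elts x `<=` elts y].
Proof.
apply/seteqP; split=> [y xy a xa|y sxy N].
  apply: contrapT => ya; have /xy[z [->]] : nbhs y (avoiding a).
    by apply: open_nbhs_nbhs; split; first exact: open_avoiding.
  by apply.
rewrite nbhsE => -[O [oO Oy] ON]; exists x; split=> //; apply: ON.
exact: open_down sxy Oy.
Qed.

Lemma generic_point (Z : set X) : closed Z -> irreducible Z ->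
  exists! x : X, closure [set x] = Z.
Proof.
move=> clZ [Z0 irrZ].
pose F := filter_from [set O : set X | open O /\ O `&` Z !=set0]
                      (fun O => O `&` Z).
have FF : ProperFilter F.
  apply: filter_from_proper => [|O [_ //]].
  apply: filter_from_filter.
    by exists setT; split; [exact: openT|rewrite setTI].
  move=> O P [oO OZ] [oP PZ]; exists (O `&` P); last by move=> x [[? ?] ?].
  split; first exact: openI.
  (* Otherwise the closed complements of [O] and [P] cover [Z], and irreducibility puts [Z] inside
     one of them. *)
  apply: contrapT => /set0P/negP/negPn/eqP OPZ.
  have [] := irrZ (~` O) (~` P); rewrite ?closedC//.
  - move=> x Zx; rewrite -setCI => OPx.
    by have : set0 x by rewrite -OPZ.
  - by case: OZ => x [Ox Zx] /(_ x Zx); apply.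
  - by case: PZ => x [Ox Zx] /(_ x Zx); apply.
have [U [UU FU]] := ultraFilterLemma FF.
have UZ : U Z.
  by apply: FU; exists setT; rewrite /= setTI//; split=> //; exact: openT.
pose x := ultrapoint UU.
have Zx : Z x.
  apply: clZ => N /cvg_ultrapoint UN; apply: (@filter_ex _ U).
  exact: filterI.
have xZ : closure [set x] = Z.
  rewrite closure_point; apply/seteqP; split=> y.
    move=> xy; have : closure [set x] y by rewrite closure_point.
    by move: (y); rewrite closureE; apply: smallest_sub => // _ ->.
  (* If [y] in [Z] misses [a], then [avoiding a] meets [Z], so its trace is in [U] and the
     ultralimit misses [a] too. *)
  move=> Zy a; apply: contraPP => ya; apply: avoiding_ultralimit; apply: FU.
  exists (avoiding a); last by move=> ? [].
  by split; [exact: open_avoiding|exists y; split].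
exists x; split=> // y; rewrite -xZ !closure_point => /seteqP[yx xy].
by apply: elts_inj; apply/seteqP; split; [exact: yx|exact: xy].
Qed.

Lemma ultralimit_spectral : spectral_space X.
Proof.
split.
- exact: ultraclosed_compact.
- exact: kolmogorov_hull_kernel.
- exact: qc_open_bigcap.
- exact: basis_qc_open.
- exact: generic_point.
Qed.

End HullKernel.

(** * Transfer of elementwise axioms to ultralimits, as in Łoś's theorem *)

Section UltralimitOfIdeals.
Variables (A : comPzSemiRingType) (X : set (hull_kernel A)).
Variables (U : set_system X) (UU : UltraFilter U).
Local Notation L := (ultralimit U).

Let eltsX (x : X) : X (elts x).
Proof. exact: set_valP. Qed.

Lemma ultralimit_in (c : A) : (forall I, X I -> I c) -> L c.
Proof. by move=> Xc; apply: filterE => x; exact: Xc. Qed.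

Lemma ultralimit_notin (c : A) : (forall I, X I -> ~ I c) -> ~ L c.
Proof.
by move=> Xc; apply: avoiding_ultralimit; apply: filterE => x; exact: Xc.
Qed.

Lemma ultralimit_imply1 (a c : A) :
  (forall I, X I -> I a -> I c) -> L a -> L c.
Proof. by move=> Xac; apply: filterS => x; exact: Xac. Qed.

Lemma ultralimit_imply2 (a b c : A) :
  (forall I, X I -> I a -> I b -> I c) -> L a -> L b -> L c.
Proof. by move=> Xabc; apply: filterS2 => x; exact: Xabc. Qed.

(** Maximality of [U] enters here: if the ultralimit misses [a], almost all members miss [a], so
    almost all contain [b]. *)
Lemma ultralimit_or (a b c : A) :
  (forall I, X I -> I c -> I a \/ I b) -> L c -> L a \/ L b.
Proof.
move=> Xcab Lc; have [|/(ultralimitPn UU) Ua] := pselect (L a); [by left|right].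
by apply: filterS2 Lc Ua => x xc xa; case: (Xcab _ (eltsX x) xc).
Qed.

Lemma ultralimit_ideal : X `<=` @is_ideal A -> is_ideal L.
Proof.
move=> XI; split.
- by apply: ultralimit_in => I /XI[].
- by move=> a b; apply: ultralimit_imply2 => I /XI[_ + _]; apply.
- by move=> a b; apply: ultralimit_imply1 => I /XI[_ _]; apply.
Qed.

Lemma ultralimit_k_ideal : X `<=` @is_k_ideal A -> is_k_ideal L.
Proof.
move=> XI; split; first by apply: ultralimit_ideal => I /XI[].
by move=> a b; apply: ultralimit_imply2 => I /XI[_]; apply.
Qed.

End UltralimitOfIdeals.

(** * Elementwise forms of properness and of primality for [k]-ideals *)

Section PrimeIdeals.
Variable A : comPzSemiRingType.
Implicit Types I P : set A.

Lemma proper_idealP I : is_ideal I -> is_proper I <-> ~ I 1.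
Proof.
move=> [_ _ IM]; split=> [pI I1|I1 IT]; last by apply: I1; rewrite IT.
by apply: pI; apply/seteqP; split=> // a _; rewrite -[a]mulr1; exact: IM.
Qed.

(* The ideal [A a] need not be a [k]-ideal; this is its subtractive closure. *)
Definition principal_k_ideal (a : A) : set A :=
  [set x | exists b c, x + b * a = c * a].

Lemma principal_k_ideal_id a : principal_k_ideal a a.
Proof. by exists 0, 1; rewrite mul0r addr0 mul1r. Qed.

Lemma is_k_ideal_principal a : is_k_ideal (principal_k_ideal a).
Proof.
split; first split.
- by exists 0, 0; rewrite !mul0r addr0.
- move=> x y [b [c xE]] [b' [c' yE]]; exists (b + b'), (c + c').
  by rewrite !mulrDl -xE -yE addrACA.
- move=> r x [b [c xE]]; exists (r * b), (r * c).
  by rewrite -!mulrA -mulrDr xE.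
(* Replacing [c * a] by [x + b * a] turns [y + (b' + c) * a] into [(x + y + b' * a) + b * a]. *)
- move=> x y [b [c xE]] [b' [c' yE]]; exists (b' + c), (c' + b).
  rewrite !mulrDl -yE -xE -!addrA addrCA; congr (_ + _).
  by rewrite addrCA addrA.
Qed.

(** Subtractivity of [P] is used once per factor: from [a * b] to [a * y], then to [x * y]. *)
Lemma principal_k_ideal_mul P a b x y : is_k_ideal P -> P (a * b) ->
  principal_k_ideal a x -> principal_k_ideal b y -> P (x * y).
Proof.
move=> [[_ _ PM] Pk] Pab [c [d xE]] [c' [d' yE]].
have Pay : P (a * y).
  apply: (Pk (c' * (a * b))); first exact: PM.
  by rewrite mulrCA -mulrDr addrC yE mulrCA; exact: PM.
apply: (Pk (c * (a * y))); first exact: PM.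
by rewrite mulrA -mulrDl addrC xE -mulrA; exact: PM.
Qed.

Lemma prime_k_idealP P :
  is_prime_k_ideal P <-> is_prime_ideal P /\ is_k_ideal P.
Proof.
split=> [[kP pP primeP]|[[iP pP primeP] kP]]; split=> //.
- split=> //; first by case: kP.
  move=> a b Pab.
  have [] := primeP _ _ (is_k_ideal_principal a) (is_k_ideal_principal b).
  + apply: smallest_sub => // _ [x ax [y bY <-]].
    exact: principal_k_ideal_mul ax bY.
  + by move=> aP; left; apply/aP/principal_k_ideal_id.
  + by move=> bP; right; apply/bP/principal_k_ideal_id.
- move=> I J kI kJ IJP.
  have [|/existsNP[a /not_implyP[Ia Pa]]] := pselect (I `<=` P).
    by left.
  right.
  move=> b Jb; have [|//|//] := primeP a b.
  by apply: IJP => K [_ IJK]; apply: IJK; exists a => //; exists b.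
Qed.

End PrimeIdeals.

Theorem proposition3p6 (A : comPzSemiRingType) :
  (spectral_space (ideals A) /\ spectral_space (proper_ideals A))
  /\ spectral_space (Spec A)
  /\ spectral_space (k_ideals A)
  /\ spectral_space (prime_k_ideals A).
Proof.
have proper1 I : is_ideal I -> is_proper I -> ~ I 1 by move=> /proper_idealP[].
(* Keeping [X] arbitrary lets this serve both prime ideals and prime [k]-ideals. *)
have prime_limit (X : set (hull_kernel A)) (U : set_system X) :
    UltraFilter U -> X `<=` @is_prime_ideal A -> is_prime_ideal (ultralimit U).
  move=> UU XP; have iL : is_ideal (ultralimit U).
    by apply: ultralimit_ideal => I /XP[].
  split=> //.
    apply/proper_idealP => //; apply: ultralimit_notin => I /XP[iI pI _].
    exact: proper1.
  by move=> a b; apply: ultralimit_or => I /XP[_ _]; apply.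
split; [split|split; [|split]]; apply: ultralimit_spectral => U UU.
- exact: ultralimit_ideal.
- have iL : is_ideal (ultralimit U) by apply: ultralimit_ideal => I [].
  split=> //; apply/proper_idealP => //.
  by apply: ultralimit_notin => I [iI pI]; exact: proper1.
- exact: prime_limit.
- exact: ultralimit_k_ideal.
- apply/prime_k_idealP; split.
    by apply: prime_limit => I /prime_k_idealP[].
  by apply: ultralimit_k_ideal => I [].
Qed.
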